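(* Let $T=(V,E)$ be a tree on $n$ vertices and let $f=\{i,j\}$ be a pair of distinct vertices of $T$ with $f\notin E$, i.e. $d_{i,j}=d>1$. Let $B=E\cup\{f\}$ and let $N=\mathrm{Min4PC}_T[B,B]$ be the $n\times n$ principal submatrix of $\mathrm{Min4PC}_T$ whose rows and columns are indexed by $B$. Write $\det(xI-N)=\sum_{k=0}^n a_kx^k$. Then the sequence $|a_0|,|a_1|,\ldots,|a_{n-2}|$ is unimodal and log-concave. Moreover, if $|a_t|=\max_{0\le k\le n-2}|a_k|$, then $\lfloor \frac{n-2}{3}\rfloor\le t\le \lceil\frac{n+1}{3}\rceil$.
   Context: For a tree $T$, $d_{i,j}$ denotes the distance (number of edges on the path) between vertices $i,j$. Let $\mathcal{V}_2$ be the set of 2-element subsets of $V$. The matrix $\mathrm{Min4PC}_T$ is the $\binom n2\times\binom n2$ matrix with rows and columns indexed by $\mathcal{V}_2$ whose entry in row $\{i,j\}$ and column $\{k,l\}$ is $\min\{d_{i,l}+d_{j,k},\ d_{i,k}+d_{j,l},\ d_{i,j}+d_{k,l}\}$. Edges of $T$ are regarded as elements of $\mathcal{V}_2$. A sequence $a_0,\dots,a_m$ is unimodal if there is an index $k$ with $a_{j-1}\le a_j$ for $j\le k$ and $a_j\ge a_{j+1}$ for $j\ge k$; it is log-concave if $a_i^2\ge a_{i-1}a_{i+1}$ for $1\le i\le m-1$. *)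

(* Defs.v *)
From mathcomp Require Import all_boot all_order all_algebra.
Set Implicit Arguments. Unset Strict Implicit. Unset Printing Implicit Defensive.
Import Order.TTheory GRing.Theory Num.Theory.

Definition edge_set n (e : rel 'I_n) : {set 'I_n * 'I_n} :=
  [set p : 'I_n * 'I_n | (p.1 < p.2)%N && e p.1 p.2].

Definition is_tree n (e : rel 'I_n) : Prop :=
  symmetric e /\ irreflexive e /\
  (forall x y : 'I_n, connect e x y) /\ #|edge_set e| = n.-1.

Definition ball n (e : rel 'I_n) (i : 'I_n) (k : nat) : {set 'I_n} :=
  iter k (fun S => S :|: [set y | [exists x in S, e x y]]) [set i].

(* Graph distance: least k with j within distance k of i
   (always < n for a connected graph). *)
Definition dist n (e : rel 'I_n) (i j : 'I_n) : nat :=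
  find (fun k => j \in ball e i k) (iota 0 n).

Definition min4pc n (e : rel 'I_n) (p q : 'I_n * 'I_n) : nat :=
  let: (i, j) := p in let: (k, l) := q in
  minn (dist e i l + dist e j k)
       (minn (dist e i k + dist e j l) (dist e i j + dist e k l)).

(* B = E ∪ {f}, with f = {i,j}; 2-subsets represented as ordered pairs (a,b), a<b. *)
Definition Bset n (e : rel 'I_n) (i j : 'I_n) : {set 'I_n * 'I_n} :=
  edge_set e :|: [set (if (i < j)%N then (i, j) else (j, i))].

(* N = Min4PC_T[B,B], indexed by an enumeration of B (the characteristic
   polynomial does not depend on the enumeration). *)
Definition Nmat n (e : rel 'I_n) (i j : 'I_n) : 'M[int]_(#|Bset e i j|) :=
  \matrix_(r, c) Posz (min4pc e (enum_val r) (enum_val c)).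

Definition unimodal (a : nat -> nat) (m : nat) : Prop :=
  exists k, (forall t, (0 < t <= k)%N -> (t <= m)%N -> (a t.-1 <= a t)%N) /\
            (forall t, (k <= t)%N -> (t < m)%N -> (a t.+1 <= a t)%N).

Definition log_concave (a : nat -> nat) (m : nat) : Prop :=
  forall t, (1 <= t)%N -> (t <= m.-1)%N -> (a t.-1 * a t.+1 <= a t * a t)%N.

(* Main.v *)
Require Import Defs.
From mathcomp Require Import all_boot all_order all_algebra.
From mathcomp Require Import zify ring.

(* Write m = n - 1 for the number of edges, d for the distance between the two
   vertices of f, and M = n - 3. Distinct edges of T have Min4PC-entry 2; the
   entry of f and an edge is d - 1 when the edge lies on the path joining the
   ends of f (d such edges) and d + 1 otherwise. Hence N + 2I has rank at most
   three and
     det (xI - N) = (x + 2)^M (x^3 - 2M x^2 - be x - ga),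
   be = m (d - 1)^2 + 4 d (m - d) + 4 (m - 1),  ga = 2 m (d - 1)^2.
   Up to sign the coefficients come from (ga, be, 2M, -1) by M multiplications
   by x + 2; log-concavity survives each of them because the only nonpositive
   coefficients stay at the top: after r steps the top two are 2 (M - r), -1.
   The mode is read off from the consecutive differences of the coefficients
   of (x + 2)^M, which change sign near M / 3. *)

Set Implicit Arguments. Unset Strict Implicit. Unset Printing Implicit Defensive.
Import Order.TTheory GRing.Theory Num.Theory.

(** * Distances in trees *)

Section Distance.
Variables (n : nat) (e : rel 'I_n).
Hypotheses (e_sym : symmetric e) (e_conn : forall x y, connect e x y).

Lemma ballS x y z k : y \in ball e x k -> e y z -> z \in ball e x k.+1.
Proof.
move=> yB yz; rewrite /ball iterS -/(ball e x k) !inE; apply/orP; right.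
by apply/existsP; exists y; rewrite yB.
Qed.

Lemma ball_succP x z k : reflect (z \in ball e x k \/ exists2 y, y \in ball e x k & e y z)
  (z \in ball e x k.+1).
Proof.
rewrite /ball iterS -/(ball e x k) !inE; apply: (iffP orP) => -[zB|H]; [by left|right|by left|right].
  by case/existsP: H => y /andP[yB yz]; exists y.
by case: H => y yB yz; apply/existsP; exists y; rewrite yB.
Qed.

Lemma ball_mono x k k' : k <= k' -> {subset ball e x k <= ball e x k'}.
Proof.
move=> /subnK <-; elim: (k' - k) => [//|m IH] y /IH yB.
by rewrite addSn; apply/ball_succP; left.
Qed.

Lemma path_ball x p : path e x p -> last x p \in ball e x (size p).
Proof.
elim/last_ind: p => [|p z IH]; first by rewrite /ball /= inE.
by rewrite rcons_path last_rcons size_rcons => /andP[/IH pB]; apply: ballS.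
Qed.

(** [find] falls back to [n] when no ball of radius below [n] contains [y], hence the restriction on
    [k]. *)
Lemma dist_leP x y k : k < n -> (dist e x y <= k) = (y \in ball e x k).
Proof.
move=> kn; rewrite /dist; apply/idP/idP => [le|yB].
  have hs : has (fun k => y \in ball e x k) (iota 0 n).
    by rewrite has_find size_iota (leq_ltn_trans le).
  apply: (ball_mono le).
  have := nth_find 0 hs; rewrite nth_iota ?add0n //.
  exact: leq_ltn_trans le kn.
rewrite leqNgt; apply/negP => lt.
by have := before_find 0 lt; rewrite nth_iota // add0n yB.
Qed.

(** A connecting path shortened to one without repetition has fewer than [n] edges, so the search in
    [dist] never returns its default. *)
Lemma dist_lt x y : dist e x y < n.
Proof.
have /connectP[p pe ->] := e_conn x y.
case/shortenP: pe => q qe uq _.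
have sq : size q < n.
  by have := max_card (mem (x :: q)); rewrite card_ord; move/card_uniqP: uq => ->.
by apply: leq_ltn_trans (sq); rewrite dist_leP ?path_ball.
Qed.

Lemma mem_ball_dist x y : y \in ball e x (dist e x y).
Proof. by rewrite -dist_leP ?dist_lt. Qed.

Lemma dist_le_ball x y k : y \in ball e x k -> dist e x y <= k.
Proof.
move=> yB; case: (ltnP k n) => kn; first by rewrite dist_leP.
by apply: leq_trans kn; apply/ltnW/dist_lt.
Qed.

Lemma dist_eq0 x y : (dist e x y == 0) = (x == y).
Proof.
have n0 : 0 < n by apply: leq_ltn_trans (dist_lt x y).
by rewrite -leqn0 dist_leP // /ball /= inE eq_sym.
Qed.

Lemma distxx x : dist e x x = 0.
Proof. by apply/eqP; rewrite dist_eq0. Qed.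

Lemma dist_stepr x y z : e y z -> dist e x z <= (dist e x y).+1.
Proof. by move=> yz; apply: dist_le_ball; apply: ballS yz; apply: mem_ball_dist. Qed.

Lemma dist_triangle x y z : dist e x z <= dist e x y + dist e y z.
Proof.
suff: forall k w, w \in ball e y k -> dist e x w <= dist e x y + k.
  by apply; apply: mem_ball_dist.
elim=> [|k IH] w.
  by rewrite /ball /= inE addn0 => /eqP->.
case/ball_succP => [/IH|[v /IH]]; first by lia.
by move=> le /(dist_stepr x); lia.
Qed.

Lemma dist_edge_le x y : e x y -> dist e x y <= 1.
Proof. by move/(dist_stepr x); rewrite distxx. Qed.

Lemma dist_sym_le x y : dist e y x <= dist e x y.
Proof.
suff: forall k w, w \in ball e x k -> dist e w x <= k.
  by apply; apply: mem_ball_dist.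
elim=> [|k IH] w.
  by rewrite /ball /= inE leqn0 dist_eq0.
case/ball_succP => [/IH|[v /IH le vw]]; first by lia.
have := dist_triangle w v x; have := @dist_edge_le w v; rewrite e_sym => /(_ vw); lia.
Qed.

Lemma distC x y : dist e x y = dist e y x.
Proof. by apply/eqP; rewrite eqn_leq !dist_sym_le. Qed.

Lemma closer_neighbour x y : x != y -> exists z, e y z && ((dist e x z).+1 == dist e x y).
Proof.
rewrite -dist_eq0; case E : (dist e x y) => [//|k] _.
have := mem_ball_dist x y; rewrite E => /ball_succP[/dist_le_ball|]; first by lia.
case=> z /dist_le_ball le zy; exists z; rewrite e_sym zy /=.
by have := dist_stepr x zy; lia.
Qed.

End Distance.

Definition ord_pair n (x y : 'I_n) := if x < y then (x, y) else (y, x).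

Lemma ord_pairC n (x y : 'I_n) : ord_pair x y = ord_pair y x.
Proof.
by rewrite /ord_pair; case: ltngtP => // /val_inj ->.
Qed.

Lemma ord_pair_eq n (x y z t : 'I_n) :
  ord_pair x y = ord_pair z t -> (x = z /\ y = t) \/ (x = t /\ y = z).
Proof. by rewrite /ord_pair; do 2 case: ifP => _; case=> -> ->; auto. Qed.

(** * Parents, parity and separation in a tree *)

Section Tree.
Variables (n : nat) (e : rel 'I_n).
Hypothesis tree : is_tree e.

Let e_sym : symmetric e. Proof. by case: tree. Qed.
Let e_irr : irreflexive e. Proof. by case: tree => _ []. Qed.
Let e_conn : forall x y, connect e x y. Proof. by case: tree => _ [_ []]. Qed.
Let e_card : #|edge_set e| = n.-1. Proof. by case: tree => _ [_ []]. Qed.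

Lemma ord_pair_edge x y : e x y -> ord_pair x y \in edge_set e.
Proof.
move=> xy; rewrite inE /ord_pair; case: (ltngtP x y) => /= [->|->|/val_inj E].
- exact: xy.
- by rewrite e_sym.
- by move: xy; rewrite E e_irr.
Qed.

Lemma edge_set_pair p : p \in edge_set e -> e p.1 p.2 /\ p = ord_pair p.1 p.2.
Proof. by case: p => x y; rewrite inE /ord_pair /= => /andP[-> ->]. Qed.

(** The next vertex on the way from [y] to the root [r]; the default [y] arises only at the root. *)
Definition parent r y := odflt y [pick z | e y z & (dist e r z).+1 == dist e r y].

Lemma parentP r y : r != y -> e y (parent r y) /\ (dist e r (parent r y)).+1 = dist e r y.
Proof.
move=> ry; rewrite /parent; case: pickP => [z /andP[yz /eqP]|no] //=.
by have [z] := closer_neighbour e_sym e_conn ry; rewrite no.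
Qed.

(* A tree has as many edges as non-root vertices, so the injection sending a
   vertex to the edge towards its parent is onto. *)
Lemma edge_parent r x y : e x y ->
  (r != x /\ y = parent r x) \/ (r != y /\ x = parent r y).
Proof.
move=> xy; pose h v := ord_pair v (parent r v).
have h_inj : {in [set~ r] &, injective h}.
  move=> v w; rewrite !inE !(eq_sym _ r) => /parentP[_ Dv] /parentP[_ Dw].
  by case/ord_pair_eq => [[-> //]|[E1 E2]]; move: Dv Dw; rewrite E2 -E1; lia.
have hE : h @: [set~ r] = edge_set e.
  apply/eqP; rewrite eqEcard card_in_imset // cardsC1 card_ord e_card leqnn andbT.
  apply/subsetP => p /imsetP[v]; rewrite in_setC1 eq_sym => /parentP[ev _] ->.
  exact: ord_pair_edge.
have := ord_pair_edge xy; rewrite -hE => /imsetP[v]; rewrite !inE eq_sym => rv.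
by case/ord_pair_eq => -[-> ->]; [left|right].
Qed.

(** One end of an edge is the parent of the other, so no edge joins vertices equidistant from [r]: a
    tree is bipartite. *)
Lemma dist_edge_parity r x y : e x y ->
  (dist e r y).+1 = dist e r x \/ (dist e r x).+1 = dist e r y.
Proof.
by case/(edge_parent r) => -[/parentP[_ H] ->]; [left|right].
Qed.

Lemma closer_unique r x y : e x y -> (dist e r y).+1 = dist e r x -> y = parent r x.
Proof.
case/(edge_parent r) => -[ne //] E D.
by have [_] := parentP ne; rewrite -E -D; lia.
Qed.

Lemma dist_edge x y : e x y -> dist e x y = 1.
Proof.
by move=> xy; case: (dist_edge_parity x xy); rewrite distxx //; lia.
Qed.

(* Deleting [k l] separates the vertices closer to [k] from those closer to [l]. *)
Lemma crossing_edge k l x y : e k l -> e x y ->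
  dist e k x < dist e l x -> dist e l y < dist e k y -> x = k /\ y = l.
Proof.
move=> kl xy kx ly.
have D z : dist e z l <= (dist e z k).+1 /\ dist e z k <= (dist e z l).+1.
  by split; apply: (dist_stepr e_conn); rewrite // e_sym.
have S := distC e_sym e_conn.
have [Dx _] := D x; have [_ Dy] := D y; rewrite !(S x, S y) in Dx Dy.
have yx : e y x by rewrite e_sym.
have s1 := dist_stepr e_conn k xy; have s2 := dist_stepr e_conn l yx.
have [h0|h0] := posnP (dist e k x).
  by split; apply/eqP; rewrite eq_sym -(dist_eq0 e_conn) ?h0 //; lia.
(* Here [dist e k x = dist e l y > 0]. Then [x] and the parent [z] of [y] towards [l] are both
   neighbours of [y] one step nearer to [k], hence equal; but [z] is nearer to [l] than [y], and [x]
   is farther. *)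
have ny : l != y by rewrite -(dist_eq0 e_conn); lia.
have [ez Dz] := parentP ny; set z := parent l y in ez Dz.
have [Dz2 Dz3] := D z; rewrite !(S z) in Dz2 Dz3.
have s3 := dist_stepr e_conn k ez; have zy : e z y by rewrite e_sym.
have s4 := dist_stepr e_conn k zy.
have E1 : x = parent k y by apply: closer_unique => //; lia.
have E2 : z = parent k y by apply: closer_unique => //; lia.
by move: E1 Dz kx; rewrite -E2 => ->; lia.
Qed.

(** The sum of the two edge lengths is 2. By [key] the other sums are at least 2 for distinct edges:
    a smaller one would force a common end with the other ends adjacent, a triangle excluded by
    parity. *)
Lemma min4pc_edges p q : p \in edge_set e -> q \in edge_set e ->
  min4pc e p q = if p == q then 0 else 2.
Proof.
case: p q => [a b] [k l] pE qE; have [/= ab pp] := edge_set_pair pE.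
have [/= kl qq] := edge_set_pair qE.
rewrite /min4pc; case: eqP => [[-> ->]|ne].
  by rewrite !distxx // addn0 min0n minn0.
rewrite (dist_edge ab) (dist_edge kl).
have key a' b' k' l' : e a' b' -> e k' l' -> (a', b') != (k', l') ->
    1 < dist e a' k' + dist e b' l'.
  move=> ab' kl' ne'; rewrite ltnNge; apply/negP => le.
  case: (posnP (dist e a' k')) => [/eqP|h1].
    rewrite dist_eq0 // => /eqP E; subst k'.
    case: (posnP (dist e b' l')) => [/eqP|h2].
      by rewrite dist_eq0 // => /eqP E; rewrite E eqxx in ne'.
    have := dist_edge_parity b' kl'; rewrite (distC e_sym e_conn b' a') (dist_edge ab'); lia.
  have /eqP : dist e b' l' = 0 by lia.
  rewrite dist_eq0 // => /eqP E; subst l'.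
  have := dist_edge_parity a' kl'; rewrite (dist_edge ab'); lia.
have n1 : (a, b) != (k, l) by apply/eqP.
have lk : e l k by rewrite e_sym.
have n2 : (a, b) != (l, k).
  apply/eqP => -[E1 E2]; apply: ne; rewrite pp qq E1 E2; exact: ord_pairC.
have := key _ _ _ _ ab kl n1; have := key _ _ _ _ ab lk n2; lia.
Qed.

(** * The path between two vertices and the entries of its pair against edges *)

Section Pair.
Variables i j : 'I_n.
Let d := dist e i j.

Let v t := iter t (parent i) j.

(** Each step lowers the distance to [i] by one and raises that to [j] by at most one; the triangle
    inequality forces equality. *)
Lemma walkP t : t <= d -> dist e i (v t) + t = d /\ dist e j (v t) = t.
Proof.
elim: t => [|t IH] td; first by rewrite /v /= distxx // addn0.
have [IH1 IH2] := IH (ltnW td).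
have ne : i != v t by rewrite -(dist_eq0 e_conn); lia.
have [ev Dv] : e (v t) (v t.+1) /\ (dist e i (v t.+1)).+1 = dist e i (v t).
  exact: parentP.
have := dist_stepr e_conn j ev; have := dist_triangle e_conn i (v t.+1) j.
rewrite (distC e_sym e_conn (v t.+1) j) -/d.
by move: IH1 IH2 ev Dv; move: (v t.+1) (v t) => y x; lia.
Qed.

Lemma walk_edge t : t < d -> e (v t) (v t.+1).
Proof.
move=> td; have [D _] := walkP (ltnW td).
by have [] // := @parentP i (v t); rewrite -(dist_eq0 e_conn); lia.
Qed.

Definition path_edges := [set ord_pair (v t) (v t.+1) | t : 'I_d].

Lemma path_edges_sub : path_edges \subset edge_set e.
Proof.
by apply/subsetP => p /imsetP[t _ ->]; apply/ord_pair_edge/walk_edge.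
Qed.

Lemma card_path_edges : #|path_edges| = d.
Proof.
rewrite card_in_imset ?cardsT ?card_ord // => s t _ _ E; apply/val_inj.
have [s1 s2] := (walkP (ltnW (ltn_ord s)), walkP (ltn_ord s)).
have [t1 t2] := (walkP (ltnW (ltn_ord t)), walkP (ltn_ord t)).
case/ord_pair_eq: E => -[E1 E2]; move: s1 s2 t1 t2; rewrite E1 E2 /=; lia.
Qed.

(** The walk from [j] to [i] starts on the side of [l] and ends on that of [k]. The step onto its
    first vertex nearer to [k] crosses the cut, so [crossing_edge] identifies it with the given
    edge. *)
Lemma split_edge_path k l : e k l ->
  dist e i k < dist e i l -> dist e j l < dist e j k -> ord_pair k l \in path_edges.
Proof.
move=> kl ik jl; have S := distC e_sym e_conn.
pose P t := (t <= d) && (dist e k (v t) < dist e l (v t)).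
have v_d : v d = i.
  by apply/eqP; rewrite eq_sym -(dist_eq0 e_conn); have := walkP (leqnn d); lia.
have exP : exists t, P t by exists d; rewrite /P leqnn v_d !(S _ i).
case: (ex_minnP exP) => -[|t] /andP[td kt] min.
  by move: kt; rewrite /v /= !(S _ j); lia.
have nP : ~~ P t by apply/negP => /min; rewrite ltnn.
have lt : dist e l (v t) < dist e k (v t).
  move: nP; rewrite /P (ltnW td) /= !(S _ (v t)).
  by have := dist_edge_parity (v t) kl; lia.
have ev : e (v t.+1) (v t) by rewrite e_sym walk_edge.
have [<- <-] := crossing_edge kl ev kt lt.
by apply/imsetP; exists (Ordinal td) => //; rewrite ord_pairC.
Qed.

(** On the path, the crosswise sum omits the edge itself and gives [d - 1]. Off the path, one end of
    the edge is farther from both [i] and [j], so both mixed sums are at least [d + 1]. *)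
Lemma min4pc_pair_edge p : p \in edge_set e ->
  min4pc e (i, j) p = if p \in path_edges then d.-1 else d.+1.
Proof.
case: p => k l pE; have [/= kl pp] := edge_set_pair pE.
have S := distC e_sym e_conn.
have tri x : d <= dist e i x + dist e j x by rewrite (S j x); apply: dist_triangle.
have tk := tri k; have tl := tri l.
have Pi := dist_edge_parity i kl; have Pj := dist_edge_parity j kl.
rewrite /min4pc (dist_edge kl) -/d; case: ifP => [/imsetP[t _]|npath].
  have [w1 w2] := (walkP (ltnW (ltn_ord t)), walkP (ltn_ord t)).
  rewrite pp => /ord_pair_eq[] [E1 E2]; move: w1 w2 {pE pp Pi Pj};
  rewrite -E1 -E2; lia.
have lk : e l k by rewrite e_sym.
have A1 : ~ (dist e i k < dist e i l /\ dist e j l < dist e j k).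
  by move=> [h1 h2]; have := split_edge_path kl h1 h2; rewrite -pp npath.
have A2 : ~ (dist e i l < dist e i k /\ dist e j k < dist e j l).
  by move=> [h1 h2]; have := split_edge_path lk h1 h2; rewrite ord_pairC -pp npath.
lia.
Qed.

End Pair.
End Tree.

(** * Coefficients of (x + 2)^M times a cubic *)

Section Unimodality.
Variables (a : nat -> nat) (m : nat).
Hypothesis a_pos : forall k, k <= m -> 0 < a k.
Hypothesis a_lc : log_concave a m.

(** For positive terms log-concavity makes the ratios [a t.+1 / a t] nonincreasing, so a ratio at
    most 1 stays so. *)
Lemma log_concave_descent s t : 0 < s <= t -> t < m -> a s <= a s.-1 -> a t.+1 <= a t.
Proof.
case/andP => s0 /subnK <-; elim: (t - s) => [|k IH] tm le.
  have := a_lc s0 ltac:(lia); have := a_pos (k := s.-1) ltac:(lia).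
  have := a_pos (k := s) ltac:(lia); rewrite add0n; nia.
have := IH ltac:(lia) le; rewrite addSn => le'.
have := a_lc (t := (k + s).+1) ltac:(lia) ltac:(lia) => /=.
have := a_pos (k := k + s) ltac:(lia); have := a_pos (k := (k + s).+1) ltac:(lia); nia.
Qed.

Lemma log_concave_unimodal : unimodal a m.
Proof.
pose P t := (t == m) || (t < m) && (a t.+1 <= a t).
have exP : exists t, P t by exists m; rewrite /P eqxx.
case: (ex_minnP exP) => k Pk min; exists k; split => t.
  case/andP => t0 tk tm; rewrite leqNgt; apply/negP => lt.
  have := min t.-1; rewrite /P prednK // (ltnW lt) tm orbT.
  by lia.
move=> kt tm; case/orP: Pk => [/eqP|/andP[km le]]; first by lia.
case: (ltngtP k t) kt => // [lt|<-] _ //.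
by apply: (@log_concave_descent k.+1).
Qed.

End Unimodality.

Local Open Scope ring_scope.

Lemma coef_mulX2 (p : {poly int}) k :
  (('X + 2) * p)`_k = 2 * p`_k + (if k is k'.+1 then p`_k' else 0).
Proof.
by rewrite mulrDl coefD coefXM mulr_natl coefMn addrC -[_ *+ 2]mulr_natl; case: k.
Qed.

Lemma coef_pow_ge0 M k : 0 <= (('X + 2) ^+ M : {poly int})`_k.
Proof.
elim: M k => [|M IH] k; first by rewrite expr0 coef1; case: eqP.
by rewrite exprS coef_mulX2; have := IH k; case: k => [|k]; [|have := IH k]; lia.
Qed.

Lemma coef_pow_gt0 M k : (k <= M)%N -> 0 < (('X + 2) ^+ M : {poly int})`_k.
Proof.
elim: M k => [|M IH] k kM; first by rewrite expr0 coef1; case: k kM.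
rewrite exprS coef_mulX2; case: k kM => [|k] kM; first by have := IH 0%N isT; lia.
by have := IH k kM; have := coef_pow_ge0 M k.+1; lia.
Qed.

(** The ratio of consecutive terms ['C(M, k) * 2 ^ (M - k)], with denominators cleared. *)
Lemma coef_pow_rec M k :
  2 * k.+1%:Z * (('X + 2) ^+ M : {poly int})`_k.+1 = (M%:Z - k%:Z) * (('X + 2) ^+ M)`_k.
Proof.
elim: M k => [|M IH] k.
  by rewrite expr0 !coef1; case: k => [|k] /=; rewrite ?mulr0 ?subrr ?mul0r.
rewrite exprS !coef_mulX2 mulrDr mulrCA IH.
have PE m : m.+1%:Z = m%:Z + 1 by rewrite -addn1 PoszD.
case: k => [|k]; first by rewrite PE; ring.
have -> : M.+1%:Z - k.+1%:Z = M%:Z - k%:Z by rewrite !PE; ring.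
by rewrite [RHS]mulrDr -(IH k) !PE; ring.
Qed.

Section Coefficients.
Variables (M : nat) (al be ga : int).

(** The cubic factor with its sign reversed, so that the low coefficients are positive. *)
Definition cubic : {poly int} := ga%:P + be%:P * 'X + al%:P * 'X^2 - 'X^3.

Hypotheses (al_eq : al = 2 * M%:Z) (be_gt0 : 0 < be) (ga_gt0 : 0 < ga).
Hypothesis lc : al * ga <= be ^+ 2.

Let q r := ('X + 2) ^+ r * cubic.

Lemma coef_qS r k : (q r.+1)`_k = 2 * (q r)`_k + (if k is k'.+1 then (q r)`_k' else 0).
Proof. by rewrite /q exprS -mulrA coef_mulX2. Qed.

(** Each factor ['X + 2] lowers the coefficient next to the leading -1 by 2. Starting at
    [al = 2 * M], it is positive until it vanishes at [r = M], which keeps everything below it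
    positive. *)
Lemma q_shape r : (r <= M)%N ->
  [/\ forall k, (k <= r.+1)%N -> 0 < (q r)`_k, (q r)`_r.+2 = 2 * (M%:Z - r%:Z),
      (q r)`_r.+3 = -1, forall k, (r.+4 <= k)%N -> (q r)`_k = 0 &
      forall k, (k <= r.+1)%N -> (q r)`_k * (q r)`_k.+2 <= (q r)`_k.+1 ^+ 2].
Proof.
elim: r => [|r IH] rM.
  have E k : (q 0)`_k = [:: ga; be; al; -1]`_k.
    rewrite /q expr0 mul1r /cubic !(coefD, coefN, coefCM, coefC, coefX, coefXn).
    by case: k => [|[|[|[|k]]]] /=; rewrite ?nth_nil; ring.
  split; rewrite ?E //=; first by case=> [|[|]] //= _; rewrite E.
      by rewrite al_eq; ring.
    by case=> [|[|[|[|k]]]] // _; rewrite E /= nth_nil.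
  case=> [|[|]] // _; rewrite !E /=; first by rewrite mulrC.
  by nia.
have [pos top1 top0 zero lcr] := IH (ltnW rM).
have top_gt0 : 0 < (q r)`_r.+2 by rewrite top1; lia.
have pos' k : (k <= r.+2)%N -> 0 < (q r)`_k.
  by rewrite leq_eqVlt => /predU1P[->|/pos].
have pos1 k : (k <= r.+2)%N -> 0 < (q r.+1)`_k.
  move=> kr; rewrite coef_qS; have := pos' k kr.
  by case: k kr => [|k] kr; [|have := pos' k (ltnW kr)]; lia.
split=> //.
- by rewrite coef_qS top0 top1; lia.
- by rewrite coef_qS zero // top0.
- by case=> // k kr; rewrite coef_qS !zero //; lia.
case=> [|k] kr; rewrite !coef_qS.
  have := lcr 0%N isT; have := pos' 0%N isT; have := pos' 1%N isT; nia.
have p0 := pos' k ltac:(lia); have p1 := pos' k.+1 ltac:(lia).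
have [kr'|] := ltnP k r.+1; last first.
  move=> rk; have ek : k = r.+1 by lia.
  by rewrite ek in p0 p1 *; rewrite top0 (zero r.+4) //; nia.
have l1 := lcr k (ltnW kr'); have l2 := lcr k.+1 kr'; have p2 := pos' k.+2 kr'.
set c0 := (q r)`_k in l1 p0 *; set c1 := (q r)`_k.+1 in l1 l2 p1 *.
set c2 := (q r)`_k.+2 in l1 l2 p2 *; set c3 := (q r)`_k.+3 in l2 *.
(* Expanding the new inequality leaves, beyond [l1] and [l2], only this cross term; multiplied by
   [c1], it follows from [c0 * c1 * c3 <= c0 * c2 ^+ 2 <= c1 ^+ 2 * c2]. *)
suff : c0 * c3 <= c1 * c2 by nia.
rewrite -(ler_pM2r p1).
have : c0 * (c1 * c3) <= c0 * c2 ^+ 2 by rewrite ler_pM2l.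
have : c2 * (c0 * c2) <= c2 * c1 ^+ 2 by rewrite ler_pM2l.
nia.
Qed.

(* The factor ['X^3] lets the recurrences below hold at every index, without
   boundary cases. *)
Let B k : int := ('X^3 * ('X + 2) ^+ M)`_k.

Lemma coef_q k : (q M)`_k = ga * B k.+3 + be * B k.+2 + al * B k.+1 - B k.
Proof.
have BE l : B l = if (l < 3)%N then 0 else (('X + 2) ^+ M : {poly int})`_(l - 3).
  by rewrite /B coefXnM.
rewrite /q /cubic; set p := ('X + 2) ^+ M in BE *.
have -> : p * (ga%:P + be%:P * 'X + al%:P * 'X^2 - 'X^3)
   = ga *: p + be *: ('X * p) + al *: ('X^2 * p) - 'X^3 * p.
  by rewrite -!mul_polyC; ring.
rewrite !(coefD, coefN, coefZ, coefXnM, coefXM) !BE.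
by case: k => [|[|[|k]]] //=; rewrite ?subSS ?subn0.
Qed.

Lemma shifted_rec k : 2 * (k%:Z - 2) * B k.+1 = (M%:Z + 3 - k%:Z) * B k.
Proof.
(* At [k = 2] the factor [k - 2] cancels the nonzero [B 3]; for smaller [k] both values of [B]
   vanish. *)
rewrite /B !coefXnM; case: k => [|[|[|k]]] /=.
- by rewrite ?mulr0 ?mul0r.
- by rewrite ?mulr0 ?mul0r.
- by rewrite ?mulr0 ?mul0r.
have := coef_pow_rec M k; rewrite !subSS !subn0.
have -> : k.+3%:Z - 2 = k.+1%:Z by lia.
by move=> ->; congr (_ * _); lia.
Qed.

(** For [k > 2] the sign of a difference is governed by [M + 7 - 3 * k]; this locates the mode. *)
Lemma shifted_diff k :
  2 * (k%:Z - 2) * (B k.+1 - B k) = (M%:Z + 7 - 3 * k%:Z) * B k.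
Proof. by rewrite mulrBr shifted_rec; ring. Qed.

Lemma shifted_ge0 k : 0 <= B k.
Proof. by rewrite /B coefXnM; case: ifP => // _; apply: coef_pow_ge0. Qed.

Lemma shifted_gt0 k : (k <= M)%N -> 0 < B k.+3.
Proof. by rewrite /B coefXnM !subSS subn0; apply: coef_pow_gt0. Qed.

Lemma shifted_eq0 k : (k < 3)%N -> B k = 0.
Proof. by rewrite /B coefXnM => ->. Qed.

(** Differencing [coef_q] weights differences of [B] by [ga], [be], [al], -1. The first two
    contributions have the right sign, and the size [2 * M] of [al] absorbs the last ([D1]). *)
Lemma coef_q_ascent k : (3 * k.+1 <= M.+1)%N -> (q M)`_k < (q M)`_k.+1.
Proof.
move=> kM; rewrite !coef_q -subr_gt0.
have D3 : 0 <= B k.+4 - B k.+3.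
  have := shifted_diff k.+3; have := shifted_ge0 k.+3; nia.
have D2 : 0 < B k.+3 - B k.+2.
  case: k kM {D3} => [|k] kM; first by rewrite (@shifted_eq0 2) // subr0 shifted_gt0.
  have := shifted_diff k.+3; have := @shifted_gt0 k ltac:(lia); nia.
have D1 : B k.+1 - B k <= al * (B k.+2 - B k.+1).
  case: k kM {D3 D2} => [|[|k]] kM.
  - by rewrite !shifted_eq0 // subrr mulr0.
  - rewrite (@shifted_eq0 2) // (@shifted_eq0 1) // !subr0 al_eq.
    by have := shifted_ge0 3; nia.
  have := shifted_diff k.+3; have := shifted_ge0 k.+3; have := shifted_ge0 k.+2.
  rewrite al_eq; set x := B k.+4 - B k.+3; set y := B k.+3 => h1 h2 h3.
  (* The difference to be bounded is at most [y], and [y <= 2 * k.+1 * x <= 2 * M * x = al * x]. *)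
  have y_le : y <= 2 * k.+1%:Z * x by nia.
  have : 2 * k.+1%:Z * x <= 2 * M%:Z * x by nia.
  lia.
have : 0 <= ga * (B k.+4 - B k.+3) by nia.
have : 0 < be * (B k.+3 - B k.+2) by nia.
lia.
Qed.

Lemma coef_q_descent k : (M + 4 <= 3 * k)%N -> (k <= M)%N -> (q M)`_k.+1 < (q M)`_k.
Proof.
move=> kM kM'; rewrite !coef_q -subr_lt0.
case: k kM kM' => [|[|k]] kM kM'; [lia|lia|].
have D3 : B k.+3.+3 - B k.+3.+2 <= 0.
  have := shifted_diff k.+3.+2; have := shifted_ge0 k.+3.+2; nia.
have D2 : B k.+3.+2 - B k.+4 < 0.
  have := shifted_diff k.+4; have := @shifted_gt0 k.+1 ltac:(lia); nia.
have D1 : al * (B k.+4 - B k.+3) <= B k.+3 - B k.+2.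
  have h := shifted_diff k.+3; have r := shifted_rec k.+2; have p := shifted_ge0 k.+3.
  rewrite al_eq; set x := B k.+4 - B k.+3 in h *; set y := B k.+3 in h r p *.
  set z := y - B k.+2.
  have hz : (M%:Z + 1 - k%:Z) * z = (M%:Z + 1 - 3 * k%:Z) * y.
    by rewrite /z mulrBr; have -> : M%:Z + 1 - k%:Z = M%:Z + 3 - k.+2%:Z by [lia]; rewrite -r; lia.
  have hx : 2 * k.+1%:Z * x = (M%:Z - 2 - 3 * k%:Z) * y by rewrite -[RHS]mulr1; lia.
  have x0 : x <= 0 by nia.
  have : 2 * M%:Z * x <= 2 * k.+1%:Z * x by nia.
  (* For [z < 0], [al * x <= 2 * k.+1 * x = (M - 2 - 3 * k) * y <= (M + 1 - 3 * k) * y = (M + 1 - k)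
     * z <= z]. *)
  case: (lerP 0 z) => z0; first by nia.
  have : (M%:Z + 1 - k%:Z) * z <= z by nia.
  nia.
have : ga * (B k.+3.+3 - B k.+3.+2) <= 0 by nia.
have : be * (B k.+3.+2 - B k.+4) < 0 by nia.
lia.
Qed.

Lemma log_concave_mode_cubic (a : nat -> nat) : (forall k, a k = absz (q M)`_k) ->
  [/\ unimodal a M.+1, log_concave a M.+1 &
    forall t, (t <= M.+1)%N -> (forall k, (k <= M.+1)%N -> (a k <= a t)%N) ->
      (M.+1 %/ 3 <= t)%N /\ (t <= (M + 6) %/ 3)%N].
Proof.
move=> aE; have [pos _ _ _ lcq] := q_shape (leqnn M).
have a_pos k : (k <= M.+1)%N -> (0 < a k)%N by move=> /pos; rewrite aE; lia.
have a_lc : log_concave a M.+1.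
  case=> // t _ tM; rewrite !aE -lez_nat !PoszM !gez0_abs -?expr2 /=.
  - by apply: lcq; lia.
  - by apply/ltW/pos; lia.
  - by apply/ltW/pos; lia.
  - by apply/ltW/pos; lia.
split=> //; first exact: log_concave_unimodal.
(* Ascent and descent are strict, so every maximiser is confined, not merely one of them. *)
move=> t tM max; split; rewrite leqNgt; apply/negP => lt.
  have h : (3 * t.+1 <= M.+1)%N by lia.
  have := coef_q_ascent h; have := max t.+1 ltac:(lia); have := pos t tM.
  by rewrite !aE; lia.
case: t tM max lt => [|t] // tM max lt.
have := @coef_q_descent t ltac:(lia) ltac:(lia); have := max t ltac:(lia).
by have := pos t.+1 tM; rewrite !aE; lia.
Qed.

End Coefficients.

(** * The characteristic polynomial *)

(** Sylvester's determinant identity without division: the block matrix [A] is made block triangular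
    by two different right factors. *)
Lemma det_scalar_sub_mul (R : comNzRingType) n k (y : R) (U : 'M[R]_(n, k)) (V : 'M[R]_(k, n)) :
  y ^+ k * \det (y%:M - U *m V) = y ^+ n * \det (y%:M - V *m U).
Proof.
pose A := block_mx y%:M U V (1%:M : 'M_k).
have detA : \det A = \det (y%:M - U *m V).
  have := det_mulmx A (block_mx 1%:M 0 (- V) 1%:M).
  rewrite det_lblock !det1 !mulr1 => <-.
  rewrite mulmx_block !mulmx1 !mulmx0 !mul1mx !add0r mulmxN subrr.
  by rewrite det_ublock det1 mulr1.
have := det_mulmx A (block_mx 1%:M (- U) 0 y%:M).
rewrite det_ublock det1 mul1r mulmx_block !mulmx1 !mulmx0 !mul1mx !addr0.
rewrite mul_mx_scalar mul_scalar_mx scalerN addNr det_lblock !det_scalar detA mulmxN addrC.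
by rewrite mulrC [in RHS]mulrC => <-; rewrite mulrC.
Qed.

Lemma det_mx33 (R : comNzRingType) (A : 'M[R]_3) :
  let a (r c : nat) := A (inord r) (inord c) in
  \det A = a 0 0 * (a 1 1 * a 2 2 - a 1 2 * a 2 1)
         - a 0 1 * (a 1 0 * a 2 2 - a 1 2 * a 2 0)
         + a 0 2 * (a 1 0 * a 2 1 - a 1 1 * a 2 0).
Proof.
move=> a.
have aE r c : A r c = a r c by rewrite /a !inord_val.
rewrite (expand_det_row _ ord0) !big_ord_recl big_ord0 /cofactor.
rewrite !(expand_det_row _ ord0) !big_ord_recl !big_ord0 /cofactor !det_mx11.
by rewrite !mxE !aE /= /bump /=; ring.
Qed.

(* [N + 2 I = 2 J + delta w^T + w delta^T] has rank at most three, with [delta] the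
   indicator of the index [f]. *)
Lemma char_poly_rank3 n (N : 'M[int]_n) (f : 'I_n) (w : 'I_n -> int) :
  w f = 0 ->
  (forall r c, N r c + (2 *+ (r == c)) = 2 + (r == f)%:R * w c + w r * (c == f)%:R) ->
  let s1 := \sum_r w r in let s2 := \sum_r w r ^+ 2 in
  ('X + 2) ^+ 3 * char_poly N = ('X + 2) ^+ n *
    (let y := 'X + 2 in
     y ^+ 3 - (2 * n%:R) * y ^+ 2 - (4 * s1%:P + s2%:P) * y
      + ((2 * n%:R - 2) * s2%:P - 2 * s1%:P ^+ 2)).
Proof.
move=> wf NE s1 s2.
pose U : 'M[{poly int}]_(n, 3) :=
  \matrix_(r, c) [:: 2; (r == f)%:R; (w r)%:P]`_c.
pose V : 'M[{poly int}]_(3, n) :=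
  \matrix_(r, c) [:: 1; (w c)%:P; (c == f)%:R]`_r.
have E : char_poly_mx N = ('X + 2)%:M - U *m V.
  apply/matrixP => r c; rewrite !mxE !big_ord_recl big_ord0 !mxE /=.
  have -> : N r c = 2 + (r == f)%:R * w c + w r * (c == f)%:R - 2 *+ (r == c).
    by rewrite -NE addrK.
  rewrite !(polyCD, polyCN, polyCM, polyCMn) !polyC1.
  by case: (r == c) (r == f) (c == f) => [] [] [] /=; rewrite ?(mulr0n, mulr1n, polyC0); ring.
rewrite /char_poly E det_scalar_sub_mul; congr (_ * _).
have sumf (F : 'I_n -> {poly int}) : \sum_r F r * (r == f)%:R = F f.
  rewrite (bigD1 f) //= eqxx mulr1 big1 ?addr0 // => r /negPf ->.
  by rewrite mulr0.
have sumP (F : 'I_n -> int) : \sum_r (F r)%:P = (\sum_r F r)%:P by rewrite rmorph_sum.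
(* The diagonal zeros come from [w f = 0]. *)
have VU : V *m U = \matrix_(r < 3, c < 3)
    (nth [::] [:: [:: 2 * n%:R; 1; s1%:P]; [:: 2 * s1%:P; 0; s2%:P]; [:: 2; 1; 0]] r)`_c.
  apply/matrixP => r c; rewrite !mxE; under eq_bigr do rewrite !mxE.
  have s2E : \sum_j (w j)%:P * (w j)%:P = s2%:P.
    by rewrite -sumP; apply: eq_bigr => j _; rewrite -polyCM -expr2.
  case: r c => [[|[|[|//]]] ?] [[|[|[|//]]] ?] /=.
  - by rewrite sumr_const card_ord mul1r mulr_natr.
  - by rewrite (sumf (fun=> 1)).
  - by rewrite -sumP; apply: eq_bigr => j _; rewrite mul1r.
  - by rewrite -mulr_suml sumP mulrC.
  - by rewrite (sumf (fun j => (w j)%:P)) wf.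
  - by [].
  - by under eq_bigr do rewrite mulrC; rewrite (sumf (fun=> 2)).
  - by rewrite (sumf (fun j => (j == f)%:R)) eqxx.
  - by under eq_bigr do rewrite mulrC; rewrite (sumf (fun j => (w j)%:P)) wf.
rewrite VU det_mx33 /= !mxE -!val_eqE /= !inordK //=.
rewrite ?mulr0n ?mulr1n; ring.
Qed.

Lemma sum_two_values (T : finType) (A S : {set T}) (x y : int) : S \subset A ->
  \sum_(p in A) (if p \in S then x else y) = #|S|%:Z * x + (#|A|%:Z - #|S|%:Z) * y.
Proof.
move=> SA; rewrite (bigID (mem S)) /=; congr (_ + _).
  rewrite (eq_bigl (mem S)) => [|p]; last by rewrite andb_idl //; apply/subsetP.
  by under eq_bigr => p /= -> do []; rewrite sumr_const -mulr_natl natz.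
rewrite (eq_bigl (mem (A :\: S))) => [|p]; last by rewrite /= !inE andbC.
under eq_bigr => p /= do rewrite inE => /andP[/negPf-> _].
rewrite sumr_const -mulr_natl natz cardsD (setIidPr SA).
by rewrite subzn // subset_leq_card.
Qed.

Lemma dist_nonadjacent n (e : rel 'I_n) (i j : 'I_n) :
  is_tree e -> i != j -> ~~ e i j -> (1 < dist e i j)%N.
Proof.
move=> [e_sym [_ [e_conn _]]] ij nij.
rewrite ltnNge; apply/negP => d1.
have [z /andP[ez]] := closer_neighbour e_sym e_conn ij.
move=> /eqP Dz; have : dist e i z == 0%N by lia.
by rewrite dist_eq0 // => /eqP iz; move: ez; rewrite -iz e_sym (negPf nij).
Qed.

Lemma char_poly_Nmat n (e : rel 'I_n) (i j : 'I_n) :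
  is_tree e -> i != j -> ~~ e i j ->
  let d := (dist e i j)%:Z in let m := n.-1%:Z in
  char_poly (Nmat e i j) =
    - (('X + 2) ^+ (n - 3) * cubic (2 * (n - 3)%N%:Z)
         (m * (d - 1) ^+ 2 + 4 * d * (m - d) + 4 * (m - 1)) (2 * m * (d - 1) ^+ 2)).
Proof.
move=> tree ij nij d m.
have [e_sym [e_irr [e_conn e_card]]] := tree.
have dn : (dist e i j < n)%N := dist_lt e_conn i j.
have d2 := dist_nonadjacent tree ij nij.
pose i' := (ord_pair i j).1; pose j' := (ord_pair i j).2.
have dE : dist e i' j' = dist e i j.
  by rewrite /i' /j' /ord_pair; case: ifP => //= _; apply: distC.
have BE : Bset e i j = (i', j') |: edge_set e.
  by rewrite /Bset setUC /i' /j' /ord_pair; case: ifP.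
have fE : (i', j') \notin edge_set e.
  rewrite inE negb_and /= /i' /j' /ord_pair.
  by case: ifP => /= _; rewrite ?(e_sym j) nij orbT.
have fB : (i', j') \in Bset e i j by rewrite BE setU11.
have Bn : #|Bset e i j| = n by rewrite BE cardsU1 fE e_card; lia.
(* The entry of [f] against an edge, [d - 1] or [d + 1], minus the constant 2 coming from [2 J]. *)
pose u p : int := if p \in path_edges e i' j' then d - 3 else d - 1.
have uE p : p \in edge_set e -> (min4pc e (i', j') p)%:Z = 2 + u p.
  move=> pE; rewrite (min4pc_pair_edge tree i' j' pE) dE /u /d; case: ifP => _; lia.
have minC p q : min4pc e p q = min4pc e q p.
  case: p q => [a b] [k l]; rewrite /min4pc.
  rewrite (distC e_sym e_conn a l) (distC e_sym e_conn b k).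
  by rewrite (distC e_sym e_conn a k) (distC e_sym e_conn b l); lia.
have minff : min4pc e (i', j') (i', j') = 0%N.
  by rewrite /min4pc !distxx // addn0 min0n minn0.
pose w0 p : int := if p == (i', j') then 0 else u p.
pose f := enum_rank_in fB (i', j').
have fv : enum_val f = (i', j') by apply: enum_rankK_in.
have eqf r : (r == f) = (enum_val r == (i', j')).
  by rewrite -fv (inj_eq enum_val_inj).
pose w (r : 'I_#|Bset e i j|) := w0 (enum_val r).
have wf : w f = 0 by rewrite /w /w0 fv eqxx.
have NE r c : Nmat e i j r c + (2 *+ (r == c)) = 2 + (r == f)%:R * w c + w r * (c == f)%:R.
  rewrite /w mxE !eqf -(inj_eq enum_val_inj) /w0.
  have : enum_val r \in (i', j') |: edge_set e by rewrite -BE enum_valP.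
  have : enum_val c \in (i', j') |: edge_set e by rewrite -BE enum_valP.
  move: (enum_val r) (enum_val c) => p q.
  rewrite !in_setU1.
  case: (eqVneq p (i', j')) => [->|np]; case: (eqVneq q (i', j')) => [->|nq];
    rewrite ?orTb ?orFb.
  + by move=> _ _; rewrite minff.
  + by move=> qE _; rewrite uE // mulr0n mulr1n mul1r mulr0 !addr0.
  + by move=> _ pE; rewrite minC uE // ?(negPf np) mulr0n mulr1n mulr1 mul0r !addr0.
  move=> qE pE; rewrite (min4pc_edges tree pE qE).
  by case: eqP => _; rewrite ?mulr0n ?mulr1n; ring.
have := char_poly_rank3 wf NE; rewrite /w.
(* Used with [g] the identity for [s1] and the square for [s2]; [g 0 = 0] discards the index [f]. *)
have sumw (g : int -> int) : g 0 = 0 -> \sum_(r < #|Bset e i j|) g (w0 (enum_val r))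
    = d * g (d - 3) + (m - d) * g (d - 1).
  move=> g0; rewrite -(big_enum_val (fun p => g (w0 p))) /= BE big_setU1 //=.
  rewrite {1}/w0 eqxx g0 add0r.
  transitivity (\sum_(p in edge_set e) (if p \in path_edges e i' j' then g (d - 3) else g (d - 1))).
    apply: eq_bigr => p pE; rewrite /w0 ifN; last by apply: contraNneq fE => <-.
    by rewrite /u; case: ifP.
  rewrite sum_two_values ?path_edges_sub // card_path_edges // dE e_card /m /d.
  by [].
rewrite (sumw id) // (sumw (fun x => x ^+ 2)) ?expr0n //=.
move: (char_poly (Nmat e i j)) => P; rewrite Bn.
(* [1 < dist e i j < n] gives [n >= 3], so the auxiliary factor [('X + 2) ^+ 3] can be cancelled. *)
have -> : ('X + 2 : {poly int}) ^+ n = ('X + 2) ^+ 3 * ('X + 2) ^+ (n - 3).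
  by rewrite -exprD; congr (_ ^+ _); lia.
rewrite -[X in _ = X -> _]mulrA => /mulfI -> //; last first.
  by rewrite expf_neq0 // -size_poly_eq0 -[2]/(2%:R) -polyC_natr size_XaddC.
have -> : n%:R = (m + 1)%:P :> {poly int} by rewrite -polyC_natr natz /m; congr (_%:P); lia.
have -> : (n - 3)%N%:Z = m - 2 by rewrite /m; lia.
rewrite -[RHS]mulrN; congr (_ * _); rewrite /cubic.
ring.
Qed.

Theorem theorem1p3 (n : nat) (e : rel 'I_n) (i j : 'I_n) :
  is_tree e -> i != j -> ~~ e i j ->
  let a := fun k : nat => absz ((char_poly (Nmat e i j))`_k)%R in
  [/\ unimodal a n.-2, log_concave a n.-2 &
      forall t, (t <= n.-2)%N ->
        (forall k, (k <= n.-2)%N -> (a k <= a t)%N) ->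
        ((n.-2) %/ 3 <= t)%N /\ (t <= (n + 1 + 2) %/ 3)%N].
Proof.
move=> tree ij nij a.
have [e_sym [_ [e_conn _]]] := tree.
have dn : (dist e i j < n)%N := dist_lt e_conn i j.
have d2 := dist_nonadjacent tree ij nij.
have -> : n.-2 = (n - 3).+1 by lia.
(* The ceiling of [(n + 1) / 3] is the floor of [(n + 3) / 3], and [M = n - 3]. *)
have -> : (n + 1 + 2 = n - 3 + 6)%N by lia.
pose d := (dist e i j)%:Z; pose m := n.-1%:Z.
have [d_gt1 d_le] : 2 <= d /\ d <= m by rewrite /d /m; lia.
have x_gt0 : 0 < m * (d - 1) ^+ 2 by rewrite mulr_gt0 ?exprn_gt0 //; lia.
have z_ge0 : 0 <= 4 * d * (m - d) by rewrite mulr_ge0 //; lia.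
apply: (@log_concave_mode_cubic _ (2 * (n - 3)%N%:Z)
  (m * (d - 1) ^+ 2 + 4 * d * (m - d) + 4 * (m - 1)) (2 * m * (d - 1) ^+ 2)).
- by [].
- by lia.
- by rewrite -mulrA; lia.
- have -> : (n - 3)%N%:Z = m - 2 by rewrite /m; lia.
  rewrite -[2 * m * _]mulrA.
  (* With [x = m * (d - 1) ^+ 2], [be >= x + 4 * (m - 1)], so [be ^+ 2 >= 8 * (m - 1) * x >= 4 * (m
     - 2) * x = al * ga]. *)
  move: (m * _) (4 * d * _) x_gt0 z_ge0 => x z x_gt0 z_ge0.
  by nia.
by move=> k; rewrite /a char_poly_Nmat // coefN abszN.
Qed.
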